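(* Let $\alpha\in(2,\infty)\setminus\mathbb{Z}$ and let $k\ge 2$ be a fixed integer. In the Chung--Lu random graph on $n$ nodes with i.i.d. weights having tail $\overline{F}(h)=\mathbb{P}(H>h)=h^{1-\alpha}l(h)$, $h\ge 1$, where $l$ is a fixed slowly varying function, let $A_k(n)$ be the expected number of cliques of size $k$. Then, as $n\to\infty$, $$A_k(n)\asymp\begin{cases} n^{\frac{k}{2}(3-k)} & \text{when } k<\alpha,\\ n^{\frac{k}{2}(3-\alpha)}\,l(\sqrt{n})^{k} & \text{when } k>\alpha.\end{cases}$$
   Context: Model (Chung--Lu variant of the rank-1 inhomogeneous random graph). There are $n$ nodes $1,\ldots,n$. Node $i$ has weight $H_i$, where $(H_1,\ldots,H_n)$ are i.i.d. copies of a random variable $H$ taking values in $[1,\infty)$ with $\overline{F}(h)=\mathbb{P}(H>h)=h^{1-\alpha}l(h)$ for $h\ge 1$, where $\alpha>2$ and $l$ is a (positive) slowly varying function, i.e. $\lim_{x\to\infty} l(\lambda x)/l(x)=1$ for every $\lambda>0$. Put $\mu=\mathbb{E}(H)$. Conditional on the weights being $h_1,\ldots,h_n$, each pair of distinct nodes $(i,j)$ is joined by an edge, independently of everything else, with probability $p_{i,j}=\min\{h_ih_j/(\mu n),1\}$. The parameters $\alpha,\mu,k$ and the function $l$ are fixed as $n\to\infty$. A clique of size $k$ is a $k$-element subset of $\{1,\ldots,n\}$ all of whose pairs of distinct nodes are joined by edges; $A_k(n)$ is the expectation of the number of such subsets. Notation: $f(n)\asymp g(n)$ means there exist $n_0\ge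 0$ and constants $0<C_1<C_2<\infty$ such that $C_1g(n)\le f(n)\le C_2g(n)$ for all $n>n_0$. *)

(* Defs.v *)
From HB Require Import structures.
From mathcomp Require Import all_boot all_order all_algebra.
From mathcomp Require Import all_classical all_reals all_analysis.
Set Implicit Arguments.
Unset Strict Implicit.
Unset Printing Implicit Defensive.
Import Order.TTheory GRing.Theory Num.Theory.
Import numFieldNormedType.Exports.

Definition cliques (V : finType) (k : nat) (e : rel V) : {set {set V}} :=
  [set S : {set V} | (#|S| == k) &&
    [forall i in S, forall j in S, (i != j) ==> e i j]]%SET.

Local Open Scope classical_set_scope.
Local Open Scope ring_scope.

(* Only the values on [1, +oo[ matter: these are the values appearing in the
   tail of a random variable with values in [1, +oo[. *)
Definition slowly_varying (R : realType) (l : R -> R) : Prop :=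
  (forall x, 1 <= x -> 0 < l x) /\
  (forall c, 0 < c -> l (c * x) / l x @[x --> +oo] --> (1 : R)).

(* f and g are extended-real valued, so the bounds include the finiteness
   of f whenever g is finite. *)
Definition same_order (R : realType) (f g : nat -> \bar R) : Prop :=
  exists (n0 : nat) (C1 C2 : R), [/\ 0 < C1, C1 < C2 &
    forall n, (n0 < n)%N ->
      (C1%:E * g n <= f n)%E /\ (f n <= C2%:E * g n)%E].

Definition identically_distributed (R : realType)
    (d d' : measure_display) (T : measurableType d) (T' : measurableType d')
    (P : probability T R) (P' : probability T' R)
    (X : {RV P >-> R}) (Y : {RV P' >-> R}) : Prop :=
  forall B : set R, measurable B -> distribution P X B = distribution P' Y B.

Definition mutually_independent (R : realType) (d : measure_display)
    (T : measurableType d) (P : probability T R) (I : finType)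
    (X : I -> {RV P >-> R}) : Prop :=
  forall (J : {set I}) (B : I -> set R),
    (forall i, i \in J -> measurable (B i)) ->
    P (\bigcap_(i in [set` J]) X i @^-1` B i) =
    (\prod_(i in J) P (X i @^-1` B i))%E.

(* f is a version of the conditional probability P(E | G), for a
   sub-sigma-algebra G: it is G-measurable and integrates to P(A `&` E) over
   each A in G. *)
Definition is_cond_prob (R : realType) (d : measure_display)
    (T : measurableType d) (P : probability T R) (G : set (set T))
    (E : set T) (f : T -> R) : Prop :=
  (forall B : set R, measurable B -> G (f @^-1` B)) /\
  (forall A, G A -> P (A `&` E) = (\int[P]_(t in A) (f t)%:E)%E).

Definition edge_prob (R : realType) (mu : R) (n : nat) (h h' : R) : R :=
  Num.min (h * h' / (mu * n%:R)) 1.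

(* W gives the node weights and adj the adjacency relation of a random graph
   on 'I_n. The last field says that the edge events of the pairs i < j are
   mutually independent given the weights (product rule for each subfamily J),
   with conditional probabilities edge_prob. *)
Record chung_lu (R : realType) (d0 : measure_display) (T0 : measurableType d0)
    (P0 : probability T0 R) (H : {RV P0 >-> R}) (n : nat)
    (d : measure_display) (T : measurableType d) (P : probability T R)
    (W : 'I_n -> {RV P >-> R}) (adj : T -> rel 'I_n) : Prop := ChungLu {
  cl_weights_indep : mutually_independent W ;
  cl_weights_copies : forall i, identically_distributed (W i) H ;
  cl_adj_sym : forall t, symmetric (adj t) ;
  cl_adj_irr : forall t, irreflexive (adj t) ;
  cl_adj_measurable : forall i j, measurable [set t | adj t i j] ;
  cl_edges : forall J : {set 'I_n * 'I_n},
    (forall e, e \in J -> (e.1 < e.2)%N) ->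
    is_cond_prob P (g_sigma_preimage (fun i => W i : T -> R))
      (\bigcap_(e in [set` J]) [set t | adj t e.1 e.2])
      (fun t => \prod_(e in J)
         edge_prob (fine 'E_P0[H]) n (W e.1 t) (W e.2 t))
}.

Definition expected_cliques (R : realType) (d : measure_display)
    (T : measurableType d) (P : probability T R) (n : nat)
    (adj : T -> rel 'I_n) (k : nat) : \bar R :=
  ('E_P[fun t => #|cliques k (adj t)|%:R])%E.

(* Main.v *)
Require Import Defs.
From HB Require Import structures.
From mathcomp Require Import all_boot all_order all_algebra.
From mathcomp Require Import all_classical all_reals all_analysis.
From mathcomp Require Import measurable_realfun ring lra zify.
Set Implicit Arguments.
Unset Strict Implicit.
Unset Printing Implicit Defensive.
Import Order.TTheory GRing.Theory Num.Theory.
Import numFieldNormedType.Exports.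
Local Open Scope classical_set_scope.
Local Open Scope ring_scope.

(** Conditioning on the weights turns the expected number of k-cliques into
    'C(n, k) times the expectation of the product, over the pairs i < j of a
    k-set S, of min(Y_i * Y_j, 1), where Y_i = H_i / m and m = sqrt(mu * n). Both
    regimes come from enclosing this product between functions that factor over
    the vertices, so that independence of the weights reduces everything to
    one-variable moments ([prob_all_joined_le], [prob_all_joined_ge]).

    When k < alpha, the moment of order k - 1 is finite, no truncation is
    felt, and the product has the order of the product of all the Y_i * Y_j,
    that is, m ^ (- k * (k - 1)): it is at most this product, and H >= 1 gives
    the matching lower bound.

    When k > alpha, cliques mostly sit on vertices of weight about m. The lower
    bound asks that all k weights exceed m, which makes all edges certain and has
    probability P(H > m) ^ k. For the upper bound, min(u, 1) <= u ^ theta for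
    every theta in [0, 1], and theta may be chosen pair by pair, depending on
    which of the Y_i are at most 1. As alpha is not an integer, this can be
    done so that each Y_i <= 1 receives a total exponent at least beta and each
    Y_i > 1 one at most gamma, for fixed gamma < alpha - 1 < beta
    ([prod_min_le_prod_powR]). By the Karamata bounds for truncated moments
    ([lower_truncated_moment], [upper_truncated_moment]), the expectation of
    Y ^ beta on Y <= 1 and of Y ^ gamma on Y > 1 is at most a constant times
    P(H > m), so that the product has expectation of order P(H > m) ^ k. Slow
    variation finally replaces l(m) by l(sqrt n). *)

(** * Bounding the product of edge probabilities by a product over vertices *)

(** If s of the k rescaled weights are at most 1 (call them small), give
    theta = 1 to pairs of small vertices, theta = 0 to pairs of large ones and
    theta = t to mixed pairs. A small vertex then receives the exponent
    (s - 1) + t * (k - s) and a large one t * s. With N the integer part of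
    alpha, t = 1 works for s < N and t = 0 for s > N; for s = N both
    inequalities leave a nonempty interval for t because alpha is strictly
    between N and N + 1. *)
Lemma exists_moment_exponents (R : realType) (alpha : R) (k : nat) :
  2 < alpha -> alpha \isn't a Num.int -> alpha < k%:R ->
  exists beta gamma : R, [/\ 0 <= gamma, gamma < alpha - 1, alpha - 1 < beta &
    forall s, (s <= k)%N -> exists t : R, [/\ 0 <= t, t <= 1,
      t * s%:R <= gamma &
      (0 < s)%N -> beta <= s%:R - 1 + t * (k%:R - s%:R)]].
Proof.
move=> alpha_gt2 alpha_nonint alpha_ltk.
have alpha_ge0 : 0 <= alpha by lra.
have := trunc_itv alpha_ge0; set N := Num.Def.trunc alpha => /andP[N_le ltN].
have {}N_le : N%:R < alpha.
  rewrite lt_neqAle N_le andbT; apply: contra alpha_nonint => /eqP <-.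
  exact: natr_int.
have N_ge2 : 2 <= N%:R :> R.
  rewrite ler_nat -ltnS -(ltr_nat R); exact: lt_trans alpha_gt2 ltN.
have N_ltk : (N < k)%N by rewrite -(ltr_nat R); exact: lt_trans N_le alpha_ltk.
rewrite -natr1 in ltN.
set f : R := alpha - N%:R.
(* For s = N, t must lie strictly between f and 1 - (1 - f) / N, and the upper
   end is at least (1 + f) / 2 since N >= 2: t0 is the midpoint of f and
   (1 + f) / 2. *)
set t0 : R := (1 + 3 * f) / 4.
have f_gt0 : 0 < f by rewrite /f; lra.
have f_lt1 : f < 1 by rewrite /f; lra.
have t0_gtf : f < t0 by rewrite /t0; lra.
have t0_lt : t0 < (1 + f) / 2 by rewrite /t0; lra.
(* beta is the exponent of small vertices for s = N and k = N + 1, the worst case;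
   gamma has to cover s = N - 1 with t = 1, and s = N with t = t0. *)
exists (N%:R - 1 + t0), (Num.max (N%:R - 1) (t0 * N%:R)); split.
- rewrite le_max; apply/orP; left; lra.
- rewrite gt_max; apply/andP; split; first lra.
  have -> : alpha = N%:R + f by rewrite /f; lra.
  have := N_ge2; move: (N%:R : R) => x hx; nra.
- have -> : alpha = N%:R + f by rewrite /f; lra.
  lra.
move=> s s_lek; have [s_ltN|s_gtN|->] := ltngtP s N.
- exists 1; split; [lra|lra| |].
    rewrite le_max mul1r; apply/orP; left.
    by rewrite lerBrDr natr1 ler_nat.
  move=> _; suff : N%:R + 1 <= k%:R :> R by lra.
  by rewrite natr1 ler_nat.
- exists 0; split; [lra|lra| |].
    rewrite le_max mul0r; apply/orP; left; lra.
  move=> _; suff : N%:R + 1 <= s%:R :> R by lra.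
  by rewrite natr1 ler_nat.
exists t0; split; [lra|lra| |].
  by rewrite le_max lexx orbT.
move=> _; have : N%:R + 1 <= k%:R :> R by rewrite natr1 ler_nat.
by move: (N%:R : R) (k%:R : R) => x y hxy; nra.
Qed.

Definition pairs_in (n : nat) (S : {set 'I_n}) : {set 'I_n * 'I_n} :=
  [set e | [&& e.1 \in S, e.2 \in S & (e.1 < e.2)%N]]%SET.

(** Collecting, at each vertex i, the shares f i j that it receives from its
    pairs: this is how a bound on pairs becomes a bound on vertices. *)
Lemma prod_pairs_in (R : comPzRingType) (n : nat) (S : {set 'I_n})
    (f : 'I_n -> 'I_n -> R) :
  \prod_(e in pairs_in S) (f e.1 e.2 * f e.2 e.1) =
  \prod_(i in S) \prod_(j in S | j != i) f i j.
Proof.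
rewrite big_split /=.
have half (g : 'I_n -> 'I_n -> R) (r : rel 'I_n) :
  \prod_(e | [&& e.1 \in S, e.2 \in S & r e.1 e.2]) g e.1 e.2 =
  \prod_(i in S) \prod_(j in S | r i j) g i j.
  by rewrite pair_big_dep.
have -> : \prod_(e in pairs_in S) f e.1 e.2 =
    \prod_(i in S) \prod_(j in S | (i < j)%N) f i j.
  by rewrite -half; apply: eq_bigl => e; rewrite inE.
have -> : \prod_(e in pairs_in S) f e.2 e.1 =
    \prod_(i in S) \prod_(j in S | (j < i)%N) f i j.
  rewrite (exchange_big_dep (mem S)) /=; last by move=> i j _ /andP[].
  transitivity (\prod_(i in S) \prod_(j in S | (i < j)%N) f j i).
    by rewrite -(half (fun i j => f j i)); apply: eq_bigl => e; rewrite inE.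
  by apply: eq_bigr => i iS; apply: eq_bigl => j; rewrite iS.
rewrite -big_split /=; apply: eq_bigr => i iS.
rewrite [RHS](bigID (fun j : 'I_n => (i < j)%N)) /=; congr (_ * _);
  apply: eq_bigl => j; rewrite -andbA; congr (_ && _);
  rewrite -(inj_eq val_inj) /=; by case: ltngtP.
Qed.

Lemma prod_pairs_in_mul (R : comPzRingType) (n k : nat) (S : {set 'I_n})
    (y : 'I_n -> R) : #|S| = k ->
  \prod_(e in pairs_in S) (y e.1 * y e.2) = \prod_(i in S) y i ^+ k.-1.
Proof.
move=> cS; rewrite (prod_pairs_in S (fun i _ => y i)).
apply: eq_bigr => i iS; rewrite prodr_const; congr (_ ^+ _).
rewrite -cS (cardD1 i S) iS /=; apply: eq_card => j.
by rewrite !inE andbC.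
Qed.

(** Interpolation between the two bounds u and 1 of min(u, 1). *)
Lemma min_mul_le_powR (R : realType) (x y t : R) : 0 < x -> 0 < y ->
  0 <= t -> t <= 1 -> Num.min (x * y) 1 <= x `^ t * y `^ t.
Proof.
move=> x0 y0 t0 t1; rewrite -powRM ?(ltW x0) ?(ltW y0)//.
have u0 : 0 < x * y by exact: mulr_gt0.
have [u1|u1] := leP (x * y) 1; first by rewrite ger1_powR ?u0.
by rewrite -(powRr0 (x * y)); apply: ler_powR => //; exact: ltW.
Qed.

Lemma prod_powR_const (R : realType) (I : finType) (A : {pred I}) (x : R)
    (c : I -> R) : 0 < x ->
  \prod_(i in A) x `^ c i = x `^ (\sum_(i in A) c i).
Proof.
move=> x0; elim/big_rec2: _ => [|i y z _ ->]; first by rewrite powRr0.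
by rewrite powRD// (gt_eqF x0) implybT.
Qed.

(** The exponents beta and gamma do not depend on y, although the theta used
    for the pairs do: this gives a single bound that factors over the vertices,
    with no case distinction on the number of small weights. *)
Lemma prod_min_le_prod_powR (R : realType) (alpha : R) (k : nat) :
  2 < alpha -> alpha \isn't a Num.int -> alpha < k%:R ->
  exists beta gamma : R, [/\ 0 <= gamma, gamma < alpha - 1, alpha - 1 < beta &
    forall n (S : {set 'I_n}) (y : 'I_n -> R), #|S| = k ->
    (forall i, i \in S -> 0 < y i) ->
    \prod_(e in pairs_in S) Num.min (y e.1 * y e.2) 1 <=
    \prod_(i in S) (if y i <= 1 then y i `^ beta else y i `^ gamma)].
Proof.
move=> alpha_gt2 alpha_nonint alpha_ltk.
have [beta [gamma [g0 gl bg H]]] :=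
  exists_moment_exponents alpha_gt2 alpha_nonint alpha_ltk.
exists beta, gamma; split=> // n S y cS y0.
pose L := [set i in S | y i <= 1]%SET.
have LS : L \subset S by apply/fintype.subsetP => i; rewrite inE => /andP[].
have cL : (#|L| <= k)%N by rewrite -cS subset_leq_card.
have [t [t0 t1 tg tb]] := H _ cL.
pose theta i j : R := if y i <= 1 then (if y j <= 1 then 1 else t)
                      else (if y j <= 1 then t else 0).
have theta_sym i j : theta i j = theta j i.
  by rewrite /theta; case: ifP; case: ifP.
have theta0 i j : 0 <= theta i j by rewrite /theta; do 2 case: ifP => //.
have theta1 i j : theta i j <= 1 by rewrite /theta; do 2 case: ifP => //.
apply: (@le_trans _ _
  (\prod_(e in pairs_in S)
     (y e.1 `^ theta e.1 e.2 * y e.2 `^ theta e.2 e.1))).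
  apply: ler_prod => -[i j]; rewrite inE /= => /and3P[iS jS _].
  rewrite (theta_sym j i) min_mul_le_powR ?y0// andbT le_min ler01 andbT.
  by rewrite mulr_ge0// ltW ?y0.
rewrite (prod_pairs_in S (fun i j => y i `^ theta i j)).
apply: ler_prod => i iS.
rewrite prodr_ge0 /=; last by move=> *; exact: powR_ge0.
rewrite (@prod_powR_const _ _ [pred j | (j \in S) && (j != i)]) ?y0//.
have sumL : \sum_(j in S | y j <= 1) (1 : R) = #|L|%:R.
  by rewrite sumr_const; congr (_%:R); apply: eq_card => j; rewrite !inE.
have sumU : \sum_(j in S | ~~ (y j <= 1)) (1 : R) = k%:R - #|L|%:R.
  have : \sum_(j in S) (1 : R) = k%:R by rewrite sumr_const cS.
  by rewrite (bigID (fun j => y j <= 1)) /= sumL => <-; ring.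
have [yi|/ltW yi] := leP (y i) 1.
  have iL : i \in L by rewrite inE iS.
  have sE : \sum_(j in [pred j | (j \in S) && (j != i)]) theta i j =
            #|L|%:R - 1 + t * (k%:R - #|L|%:R).
    have : \sum_(j in S) theta i j = theta i i +
        \sum_(j in [pred j | (j \in S) && (j != i)]) theta i j.
      by rewrite (bigD1 i).
    rewrite {2}/theta yi.
    rewrite (bigID (fun j => y j <= 1)) /=.
    rewrite (eq_bigr (fun=> 1)); last by move=> j /andP[_ yj]; rewrite /theta yi yj.
    rewrite sumL (eq_bigr (fun=> t * 1)); last first.
      by move=> j /andP[_ /negbTE yj]; rewrite /theta yi yj mulr1.
    rewrite -big_distrr /= sumU => E.
    by apply: (@addrI _ 1); rewrite -E; ring.
  rewrite sE ger_powR ?yi ?y0// tb//.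
  by apply/card_gt0P; exists i.
have [yi1|yi1] := eqVneq (y i) 1; first by rewrite yi1 !powR1.
have yi' : (y i <= 1) = false by apply/negbTE; rewrite -ltNge lt_def yi1.
rewrite ler_powR//; apply: le_trans tg.
have sE : \sum_(j in S) theta i j = t * #|L|%:R.
  rewrite (bigID (fun j => y j <= 1)) /=.
  rewrite (eq_bigr (fun=> t * 1)); last first.
    by move=> j /andP[_ yj]; rewrite /theta yi' yj mulr1.
  rewrite -big_distrr /= sumL big1 ?addr0//.
  by move=> j /andP[_ /negbTE yj]; rewrite /theta yi' yj.
by rewrite -sE [leRHS](bigD1 i)//= lerDr.
Qed.

(** * Truncated moments of a regularly varying tail *)

Section truncated_moments.
Context (R : realType) (d : measure_display) (T : measurableType d)
  (P : probability T R) (X : {RV P >-> R}).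
Local Open Scope ereal_scope.

Lemma measurable_fun_powR_RV (p : R) (D : set T) :
  measurable_fun D (fun t => (X t `^ p)%:E).
Proof.
apply/measurable_EFinP; apply: (@measurable_funTS _ _ _ _ D).
exact: measurableT_comp (measurable_powR p) _.
Qed.

Lemma measurable_RV_gt (x : R) : measurable [set t | (x < X t)%R].
Proof.
rewrite (_ : [set t | _] = X @^-1` `]x, +oo[%classic).
  exact: measurable_funPTI.
by apply/seteqP; split=> t /=; rewrite in_itv/= andbT.
Qed.

Lemma measurable_RV_le (x : R) : measurable [set t | (X t <= x)%R].
Proof.
rewrite (_ : [set t | _] = X @^-1` `]-oo, x]%classic).
  exact: measurable_funPTI.
by apply/seteqP; split=> t /=; rewrite in_itv.
Qed.

Lemma integral_powR_le (p M : R) (D : set T) : (0 <= p)%R -> measurable D ->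
  (forall t, D t -> 0 <= X t <= M)%R ->
  \int[P]_(t in D) (X t `^ p)%:E <= (M `^ p)%:E * P D.
Proof.
move=> p0 mD XM; rewrite -integral_cst//; apply: ge0_le_integral => //.
- by move=> t _; rewrite lee_fin powR_ge0.
- exact: measurable_fun_powR_RV.
- move=> t Dt; rewrite lee_fin; have /andP[? ?] := XM t Dt.
  by apply: ge0_ler_powR; rewrite ?nnegrE// (le_trans _ (_ : X t <= M)%R).
Qed.

Context (G : R -> R) (x0 : R).
Hypotheses (x0_gt0 : (0 < x0)%R) (X_ge0 : forall t, (0 <= X t)%R)
  (G_gt0 : forall x, (x0 <= x)%R -> (0 < G x)%R)
  (X_tail : forall x, (x0 <= x)%R -> P [set t | (x < X t)%R] = (G x)%:E).

Lemma tail_nonincreasing x y : (x0 <= x)%R -> (x <= y)%R -> (G y <= G x)%R.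
Proof.
move=> hx xy; rewrite -lee_fin -!X_tail//; last exact: le_trans xy.
rewrite le_measure ?inE//; try exact: measurable_RV_gt.
by move=> t /=; exact: le_lt_trans.
Qed.

(** Karamata bound below the truncation level m. Doubling m adds at most
    (2 * m) ^ beta * G m to the moment, while m ^ beta * G m grows by a factor
    at least 2 ^ beta * a > 1; so the bound propagates from [x0, 2 * x0]
    to all levels by repeated doubling. *)
Lemma lower_truncated_moment (a beta : R) : (0 <= beta)%R ->
  (2 `^ (- beta) < a)%R ->
  (forall x, (x0 <= x)%R -> (a * G x <= G (2 * x))%R) ->
  exists2 C : R, (0 < C)%R & forall m, (x0 <= m)%R ->
    \int[P]_(t in [set t | (X t <= m)%R]) (X t `^ beta)%:E <=
      (C * (m `^ beta * G m))%:E.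
Proof.
move=> beta0 betaa aG; have x0_pos := x0_gt0.
have q0 : (0 < 2 `^ beta :> R)%R by rewrite powR_gt0.
have qE : (2 `^ (- beta) = (2 `^ beta)^-1 :> R)%R by rewrite powRN.
have a0 : (0 < a)%R by apply: lt_trans betaa; rewrite powR_gt0.
have qa1 : (1 < 2 `^ beta * a)%R.
  by rewrite mulrC -ltr_pdivrMr// div1r -qE.
set q := (2 `^ beta)%R in q0 qE qa1 *.
have G20 : (0 < G (2 * x0))%R by apply: G_gt0; lra.
pose C := (((G (2 * x0))^-1 + q / (q * a - 1)))%R.
have C0 : (0 < C)%R.
  by apply: addr_gt0; rewrite ?invr_gt0// divr_gt0// subr_gt0.
(* The constant is chosen to be stable under the doubling step. *)
have Cstep : (C + q <= C * (q * a))%R.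
  have : (q / (q * a - 1) <= C)%R by rewrite lerDr invr_ge0 ltW.
  rewrite ler_pdivrMr ?subr_gt0//; lra.
exists C => //.
have base m : (x0 <= m)%R -> (m <= 2 * x0)%R ->
    \int[P]_(t in [set t | (X t <= m)%R]) (X t `^ beta)%:E <=
    (C * (m `^ beta * G m))%:E.
  move=> m1 m2; apply: (@le_trans _ _ ((m `^ beta)%:E * 1)).
    apply: (@le_trans _ _ ((m `^ beta)%:E * P [set t | (X t <= m)%R])).
      apply: integral_powR_le => //; first exact: measurable_RV_le.
      by move=> t /= ->; rewrite X_ge0.
    apply: lee_wpmul2l; first by rewrite lee_fin powR_ge0.
    by apply: probability_le1; exact: measurable_RV_le.
  rewrite mule1 lee_fin mulrCA ler_peMr ?powR_ge0//.
  rewrite -[leLHS](@mulVf _ (G (2 * x0))) ?gt_eqF//.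
  apply: ler_pM; rewrite ?invr_ge0 ?(ltW G20)//.
    by rewrite lerDl divr_ge0 ?(ltW q0)// subr_ge0 ltW.
  exact: tail_nonincreasing.
have step j : forall m, (x0 <= m)%R -> (m <= 2 ^+ j * x0)%R ->
    \int[P]_(t in [set t | (X t <= m)%R]) (X t `^ beta)%:E <=
    (C * (m `^ beta * G m))%:E.
  elim: j => [|j IH] m m1 m2; first by apply: base => //; lra.
  have [mx|mx] := leP m (2 * x0)%R; first exact: base.
  have [h hE] : exists h : R, m = (2 * h)%R by exists (m / 2)%R; lra.
  have h1 : (x0 <= h)%R by lra.
  have h2 : (h <= 2 ^+ j * x0)%R.
    by move: m2; rewrite exprS -mulrA hE ler_pM2l.
  have -> : [set t | (X t <= m)%R] =
      [set t | (X t <= h)%R] `|` [set t | (X t <= m)%R] `&` [set t | (h < X t)%R].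
    apply/seteqP; split=> t /=.
      by move=> Xm; case: (leP (X t) h) => Xh; [left|right].
    case=> [Xh|[]//]; apply: (le_trans Xh); lra.
  have mD : measurable ([set t | (X t <= m)%R] `&` [set t | (h < X t)%R]).
    by apply: measurableI; [exact: measurable_RV_le|exact: measurable_RV_gt].
  rewrite ge0_integral_setU//=; last 4 first.
  - exact: measurable_RV_le.
  - exact: measurable_fun_powR_RV.
  - by move=> t _; rewrite lee_fin powR_ge0.
  - apply/disj_setPS => t [/= Xh [_ hX]].
    by move: (lt_le_trans hX Xh); rewrite ltxx.
  apply: (@le_trans _ _ ((C * (h `^ beta * G h))%:E + (m `^ beta * G h)%:E)).
    apply: leeD; first exact: IH.
    rewrite EFinM -X_tail//.
    apply: (@le_trans _ _ ((m `^ beta)%:E *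
        P ([set t | (X t <= m)%R] `&` [set t | (h < X t)%R]))).
      apply: integral_powR_le => // t /= [-> _].
      by rewrite X_ge0.
    apply: lee_wpmul2l; first by rewrite lee_fin powR_ge0.
    by rewrite le_measure ?inE//; exact: measurable_RV_gt.
  rewrite -EFinD lee_fin hE powRM ?ler0n//; last by lra.
  rewrite -/q.
  have hb : (0 <= h `^ beta)%R by rewrite powR_ge0.
  have Gh := G_gt0 h1.
  apply: (@le_trans _ _ ((h `^ beta * G h) * (C + q))%R); first by lra.
  apply: (@le_trans _ _ ((h `^ beta * G h) * (C * (q * a)))%R).
    by rewrite ler_wpM2l// mulr_ge0// ltW.
  apply: (@le_trans _ _ ((h `^ beta * C * q) * (a * G h))%R); first by lra.
  apply: (@le_trans _ _ ((h `^ beta * C * q) * G (2 * h))%R); last by lra.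
  by rewrite ler_wpM2l ?aG// !mulr_ge0// ltW.
move=> m mx0; apply: (step (Num.bound (m / x0))) => //.
rewrite -ler_pdivrMr//.
have m0 : (0 <= m / x0)%R by rewrite divr_ge0 ?(ltW x0_gt0)// (le_trans _ mx0) ?ltW.
apply: (le_trans (ltW (archi_boundP m0))).
by rewrite -natrX ler_nat ltnW// ltn_expl.
Qed.

(** Karamata bound above the truncation level m. The dyadic layer from m to
    2 * m contributes at most (2 * m) ^ gamma * G m, and m ^ gamma * G m
    shrinks by a factor at most 2 ^ gamma * b < 1 at each doubling, so the
    layers sum as a geometric series. The induction runs on the number of
    layers; monotone convergence concludes. *)
Lemma upper_truncated_moment (b gamma : R) : (0 <= gamma)%R ->
  (0 < b)%R -> (b < 2 `^ (- gamma))%R ->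
  (forall x, (x0 <= x)%R -> (G (2 * x) <= b * G x)%R) ->
  exists2 C : R, (0 < C)%R & forall m, (x0 <= m)%R ->
    \int[P]_(t in [set t | (m < X t)%R]) (X t `^ gamma)%:E <=
      (C * (m `^ gamma * G m))%:E.
Proof.
move=> gamma0 b0 bgamma Gb; have x0_pos := x0_gt0.
have q0 : (0 < 2 `^ gamma :> R)%R by rewrite powR_gt0.
have qE : (2 `^ (- gamma) = (2 `^ gamma)^-1 :> R)%R by rewrite powRN.
have qb1 : (2 `^ gamma * b < 1)%R.
  by rewrite mulrC -ltr_pdivlMr// div1r -qE.
set q := (2 `^ gamma)%R in q0 qE qb1 *.
(* C is the sum of the geometric series of ratio q * b and first term q. *)
pose C := (q / (1 - q * b))%R.
have C0 : (0 < C)%R by rewrite divr_gt0// subr_gt0.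
have Cstep : (q + C * (q * b) = C)%R.
  have : (C * (1 - q * b) = q)%R by rewrite mulfVK// gt_eqF// subr_gt0.
  lra.
exists C => //.
pose D (m : R) j := [set t | (m < X t)%R] `&` [set t | (X t <= 2 ^+ j * m)%R].
have mD m j : measurable (D m j).
  by apply: measurableI; [exact: measurable_RV_gt|exact: measurable_RV_le].
have step j : forall m, (x0 <= m)%R ->
    \int[P]_(t in D m j) (X t `^ gamma)%:E <= (C * (m `^ gamma * G m))%:E.
  elim: j => [|j IH] m mx0.
    have -> : D m 0%N = set0.
      apply/seteqP; split=> t //= [/=]; rewrite expr0 mul1r => /lt_le_trans h.
      by move=> /h; rewrite ltxx.
    rewrite integral_set0 lee_fin mulr_ge0 ?(ltW C0)// mulr_ge0 ?powR_ge0//.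
    by rewrite ltW// G_gt0.
  have m0 : (0 < m)%R by exact: lt_le_trans mx0.
  have DE : D m j.+1 `<=` D m 1%N `|` D (2 * m)%R j.
    move=> t [/= mX]; rewrite exprSr -mulrA => Xm.
    by case: (leP (X t) (2 * m)%R) => h; [left|right]; split=> //=; rewrite expr1.
  have disj : [disjoint D m 1%N & D (2 * m)%R j].
    apply/disj_setPS => t [[/= _ h1] [/= h2 _]].
    by move: (lt_le_trans h2 h1); rewrite expr1 ltxx.
  apply: (@le_trans _ _
    (\int[P]_(t in D m 1%N `|` D (2 * m)%R j) (X t `^ gamma)%:E)).
    apply: ge0_subset_integral => //; first exact: measurableU.
      exact: measurable_fun_powR_RV.
    by move=> t _; rewrite lee_fin powR_ge0.
  rewrite ge0_integral_setU//=; last 2 first.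
  - exact: measurable_fun_powR_RV.
  - by move=> t _; rewrite lee_fin powR_ge0.
  have m2x0 : (x0 <= 2 * m)%R by lra.
  apply: (@le_trans _ _ (((2 * m) `^ gamma * G m)%:E +
                         (C * ((2 * m) `^ gamma * G (2 * m)))%:E)).
    apply: leeD; last exact: IH.
    rewrite EFinM -X_tail//.
    apply: (@le_trans _ _ (((2 * m) `^ gamma)%:E * P (D m 1%N))).
      apply: integral_powR_le => // t [/= _]; rewrite expr1 => ->.
      by rewrite X_ge0.
    apply: lee_wpmul2l; first by rewrite lee_fin powR_ge0.
    by rewrite le_measure ?inE//; [exact: measurable_RV_gt|exact: subIsetl].
  rewrite -EFinD lee_fin powRM ?ler0n ?(ltW m0)// -/q -[in leRHS]Cstep.
  have mg : (0 <= m `^ gamma)%R by rewrite powR_ge0.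
  have -> : ((q + C * (q * b)) * (m `^ gamma * G m) =
    q * m `^ gamma * G m + (C * (q * m `^ gamma)) * (b * G m))%R by ring.
  rewrite lerD2l mulrA ler_wpM2l ?Gb//.
  by apply: mulr_ge0; rewrite ?(ltW C0)// mulr_ge0// ltW.
move=> m mx0.
have m0 : (0 < m)%R by exact: lt_le_trans mx0.
have DU : [set t | (m < X t)%R] = \bigcup_j D m j.
  apply/seteqP; split=> t /=; last by case=> j _ [].
  move=> mX; exists (Num.bound (X t / m)) => //; split=> //=.
  rewrite -ler_pdivrMr//.
  have /archi_boundP/ltW : (0 <= X t / m)%R by rewrite divr_ge0// ltW.
  by move=> /le_trans; apply; rewrite -natrX ler_nat ltnW// ltn_expl.
have := @ge0_nondecreasing_set_cvg_integral _ _ _ (D m)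
  (fun t => (X t `^ gamma)%:E) P _ (mD m).
rewrite -DU => /(_ _ _ _)/cvge_to_le; apply.
- move=> i j ij; apply/subsetPset => t [/= mX Xi]; split=> //=.
  apply: le_trans Xi _; rewrite ler_wpM2r ?(ltW m0)//.
  by rewrite ler_weXn2l// ler1n.
- by move=> i; exact: measurable_fun_powR_RV.
- by move=> i t _; rewrite lee_fin powR_ge0.
- by apply: nearW => j; exact: step.
Qed.

End truncated_moments.

(** * Expectation of a product of independent variables *)

Section independent_expectation.
Context (R : realType) (d : measure_display) (T : measurableType d)
  (P : probability T R).
Local Open Scope ereal_scope.
Import HBNNSimple.

(** From indicators of events of X to functions of X: the identity is linear in
    f and stable under increasing limits, so it extends from indicators to
    simple functions and to all nonnegative measurable functions. *)
Lemma integral_comp_factor (X : {RV P >-> R}) (Y : T -> R) (c : R)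
    (f : R -> R) :
  measurable_fun setT Y -> (forall t, (0 <= Y t)%R) ->
  measurable_fun setT f -> (forall x, (0 <= f x)%R) ->
  (forall B, measurable B ->
    \int[P]_(t in X @^-1` B) (Y t)%:E = c%:E * P (X @^-1` B)) ->
  \int[P]_t (f (X t) * Y t)%:E = c%:E * \int[P]_t (f (X t))%:E.
Proof.
move=> mY Y0 mf f0 XY.
have mX : measurable_fun setT X by [].
have mEf : measurable_fun setT (EFin \o f) by exact/measurable_EFinP.
have mEY : measurable_fun setT (fun t => (Y t)%:E) by exact/measurable_EFinP.
have simple (h : {nnsfun R >-> R}) :
    \int[P]_t (h (X t) * Y t)%:E = c%:E * \int[P]_t (h (X t))%:E.
  pose s : seq R := finmap.enum_fset (fset_set (range h)).
  pose i (v : R) t : R := \1_(h @^-1` [set v]) (X t).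
  have hE t : h (X t) = (\sum_(v <- s) v * i v t)%R.
    by rewrite fimfunE fsbig_finite.
  have mi v : measurable_fun setT (i v).
    apply: measurableT_comp mX; exact: measurable_indic.
  have i0 v t : (0 <= i v t)%R by [].
  (* Values of h are nonnegative, so negative v contribute a zero indicator. *)
  have vi (v : R) t : (v * i v t = Num.max v 0 * i v t)%R.
    have [v0|//] := leP v 0%R; rewrite mul0r.
    move: v0; rewrite le_eqVlt => /predU1P[->|v0]; first by rewrite mul0r.
    rewrite /i indicE memNset ?mulr0// => hx.
    by have : (0 <= h (X t))%R by []; rewrite hx leNgt v0.
  have w0 (v : R) : (0 <= Num.max v 0)%R by rewrite le_max lexx orbT.
  under eq_integral.
    move=> t _; rewrite hE mulr_suml -sumEFin.
    under eq_bigr do rewrite vi -mulrA EFinM.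
    over.
  under [in RHS]eq_integral.
    move=> t _; rewrite hE -sumEFin.
    under eq_bigr do rewrite vi EFinM.
    over.
  rewrite !ge0_integral_sum//; last 4 first.
  - move=> v; apply: emeasurable_funM => //; exact/measurable_EFinP.
  - by move=> v t _; rewrite -EFinM lee_fin mulr_ge0.
  - move=> v; apply: emeasurable_funM => //; apply/measurable_EFinP.
    exact: measurable_funM.
  - by move=> v t _; rewrite -EFinM lee_fin !mulr_ge0.
  rewrite ge0_sume_distrr; last first.
    move=> v _; apply: integral_ge0 => t _.
    by rewrite -EFinM lee_fin mulr_ge0.
  apply: eq_bigr => v _.
  have mXB : measurable (X @^-1` (h @^-1` [set v])) by exact: measurable_funPTI.
  rewrite !ge0_integralZl//; last 6 first.
  - exact/measurable_EFinP.
  - by move=> t _; rewrite lee_fin.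
  - by rewrite lee_fin w0.
  - by apply/measurable_EFinP; exact: measurable_funM.
  - by move=> t _; rewrite lee_fin mulr_ge0.
  - by rewrite lee_fin w0.
  rewrite muleCA; congr (_ * _).
  have -> : \int[P]_t (i v t)%:E = P (X @^-1` (h @^-1` [set v])).
    by rewrite -[X in _ = P X]setIT -integral_indic.
  rewrite -XY// [RHS]integral_mkcond; apply: eq_integral => t _.
  rewrite patchE /i indicE; case: ifPn => tB.
    by rewrite mem_set ?mul1r//; move: tB => /set_mem.
  by rewrite memNset ?mul0r//; move: tB => /negP tB /mem_set.
pose h := nnsfun_approx measurableT mEf.
have h_cvg x : (h n x)%:E @[n --> \oo] --> (f x)%:E.
  by apply: cvg_nnsfun_approx => // y _; rewrite lee_fin.
have h_nd x : {homo (fun n => h n x) : m n / (m <= n)%N >-> (m <= n)%R}.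
  by move=> m n mn; have /lefP := nd_nnsfun_approx measurableT mEf mn; exact.
have mh n : measurable_fun setT (fun t => h n (X t)).
  by apply: measurableT_comp.
have cvgL : \int[P]_t (h n (X t) * Y t)%:E @[n --> \oo] -->
            \int[P]_t (f (X t) * Y t)%:E.
  rewrite (eq_integral (fun t => limn (fun n => (h n (X t) * Y t)%:E))).
    apply: cvg_monotone_convergence => //.
    - by move=> n; apply/measurable_EFinP; exact: measurable_funM.
    - by move=> n t _; rewrite lee_fin mulr_ge0.
    - by move=> t _ m n mn; rewrite lee_fin ler_wpM2r// h_nd.
  move=> t _; apply/esym/cvg_lim => //.
  under eq_fun do rewrite EFinM.
  by rewrite EFinM; apply: cvgeZr => //; exact: h_cvg.
have cvgR : \int[P]_t (h n (X t))%:E @[n --> \oo] --> \int[P]_t (f (X t))%:E.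
  rewrite (eq_integral (fun t => limn (fun n => (h n (X t))%:E))).
    apply: cvg_monotone_convergence => //.
    - by move=> n; apply/measurable_EFinP.
    - by move=> n t _; rewrite lee_fin.
    - by move=> t _ m n mn; rewrite lee_fin h_nd.
  by move=> t _; apply/esym/cvg_lim => //; exact: h_cvg.
have cvgL' : \int[P]_t (h n (X t) * Y t)%:E @[n --> \oo] -->
             c%:E * \int[P]_t (f (X t))%:E.
  rewrite (_ : (fun n => _) = (fun n => c%:E * \int[P]_t (h n (X t))%:E)).
    exact: cvgeZl.
  by apply/funext => n; exact: simple.
exact: (cvg_unique _ cvgL cvgL').
Qed.

(** Mixed form interpolating between the product rule for events (s empty) and
    the product rule for expectations (J empty): each step of the induction on
    s replaces one event X i \in B i by the function g i of X i. *)
Lemma indep_integral_prod_cond (I : finType) (X : I -> {RV P >-> R})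
    (g : I -> R -> R) (e : I -> R) :
  mutually_independent X ->
  (forall i, measurable_fun setT (g i)) -> (forall i x, (0 <= g i x)%R) ->
  (forall i, \int[P]_t (g i (X i t))%:E = (e i)%:E) ->
  forall (s : seq I) (J : {set I}) (B : I -> set R),
    uniq s -> (forall i, i \in s -> i \notin J) ->
    (forall i, i \in J -> measurable (B i)) ->
  \int[P]_(t in \bigcap_(i in [set` J]) X i @^-1` B i)
     (\prod_(i <- s) g i (X i t))%:E =
  (\prod_(i <- s) e i * \prod_(i in J) fine (P (X i @^-1` B i)))%:E.
Proof.
move=> indX mg g0 ge s; elim: s => [|i s IH] J B /=.
  move=> _ _ mB; under eq_integral do rewrite big_nil.
  rewrite big_nil mul1r.
  have mD : measurable (\bigcap_(i in [set` J]) X i @^-1` B i).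
    apply: fin_bigcap_measurable; first exact: finite_finset.
    by move=> i /= iJ; apply: measurable_funPTI; exact: mB.
  rewrite (integral_cst P mD 1%E) mul1e.
  apply: (etrans (indX J B mB)).
  rewrite -prodEFin; apply: eq_bigr => i iJ; rewrite fineK//.
  by apply: fin_num_measure; apply: measurable_funPTI; exact: mB.
move=> /andP[iNs us] sJ mB.
pose B0 C j := if j == i then C else B j.
have iJ : i \notin J by apply: sJ; rewrite mem_head.
pose D := \bigcap_(i in [set` J]) X i @^-1` B i.
have mD : measurable D.
  apply: fin_bigcap_measurable; first exact: finite_finset.
  by move=> j /= jJ; apply: measurable_funPTI; exact: mB.
have mgX j : measurable_fun setT (fun t => g j (X j t)).
  exact: measurableT_comp.
pose Y t := (\1_D t * \prod_(j <- s) g j (X j t))%R.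
have -> : (\prod_(j <- i :: s) e j * \prod_(j in J) fine (P (X j @^-1` B j)))%:E
   = (\prod_(j <- s) e j * \prod_(j in J) fine (P (X j @^-1` B j)))%:E *
     \int[P]_t (g i (X i t))%:E.
  by rewrite ge -EFinM big_cons; congr EFin; ring.
rewrite -(@integral_comp_factor _ Y)//.
- rewrite integral_mkcond; apply: eq_integral => t _.
  rewrite patchE /Y indicE big_cons; case: ifPn => tD; rewrite ?mul0r ?mulr0//.
  by rewrite mul1r.
- apply: measurable_funM; first exact: measurable_indic.
  exact: measurable_prod.
- by move=> t; rewrite mulr_ge0// prodr_ge0.
move=> C mC.
have B0i : B0 C i = C by rewrite /B0 eqxx.
have B0J j : j \in J -> B0 C j = B j.
  by move=> jJ; rewrite /B0 (negbTE (_ : j != i))//; apply: contraNneq iJ => <-.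
transitivity (\int[P]_(t in \bigcap_(j in [set` (i |: J)%SET]) X j @^-1` B0 C j)
    (\prod_(j <- s) g j (X j t))%:E).
  rewrite [LHS]integral_mkcond [RHS]integral_mkcond; apply: eq_integral => t _.
  rewrite !patchE /Y indicE.
  have -> : (t \in \bigcap_(j in [set` (i |: J)%SET]) X j @^-1` B0 C j) =
      (t \in X i @^-1` C) && (t \in D).
    apply/idP/andP => [/set_mem tU|[/set_mem tC /set_mem tD]].
      split; apply/mem_set.
        by have := tU i; rewrite /= setU11 B0i; exact.
      by move=> j /= jJ; have := tU j; rewrite /= in_setU1 jJ orbT B0J//; exact.
    apply/mem_set => j /=; rewrite in_setU1 => /predU1P[->|jJ].
      by rewrite B0i.
    by rewrite B0J//; exact: tD.
  by case: (t \in X i @^-1` C) => //=; case: (t \in D); rewrite ?mul1r ?mul0r.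
rewrite IH//; last 2 first.
- move=> j js; rewrite in_setU1 negb_or sJ ?inE ?js ?orbT// andbT.
  by apply: contraNneq iNs => <-.
- by move=> j; rewrite in_setU1 => /predU1P[->|jJ]; rewrite ?B0i ?B0J//; exact: mB.
rewrite big_setU1//= B0i mulrCA mulrC EFinM fineK; last first.
  by apply: fin_num_measure; exact: measurable_funPTI.
congr (_%:E * _); congr (_ * _)%R; apply: eq_bigr => j jJ.
by rewrite B0J.
Qed.

Lemma indep_integral_prod (I : finType) (X : I -> {RV P >-> R})
    (g : I -> R -> R) (e : I -> R) (S : {set I}) :
  mutually_independent X ->
  (forall i, measurable_fun setT (g i)) -> (forall i x, (0 <= g i x)%R) ->
  (forall i, \int[P]_t (g i (X i t))%:E = (e i)%:E) ->
  \int[P]_t (\prod_(i in S) g i (X i t))%:E = (\prod_(i in S) e i)%:E.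
Proof.
move=> indX mg g0 ge.
have := @indep_integral_prod_cond _ _ _ _ indX mg g0 ge (enum S) finset.set0
  (fun=> setT) (enum_uniq (mem S)).
rewrite big_set0 mulr1 big_enum => <-; last 2 first.
- by move=> i _; rewrite inE.
- by move=> i; rewrite inE.
rewrite (_ : \bigcap_(i in _) _ = setT).
  by apply: eq_integral => t _; rewrite big_enum.
by apply/seteqP; split=> // t _ i /=; rewrite inE.
Qed.

End independent_expectation.

(** * Expected number of cliques *)

Lemma measurable_fun_prod_in (R : realType) (d : measure_display)
    (T : measurableType d) (I : finType) (A : {pred I}) (f : I -> T -> R) :
  (forall i, measurable_fun setT (f i)) ->
  measurable_fun setT (fun t => \prod_(i in A) f i t).
Proof.
by move=> mf; under eq_fun do rewrite -big_enum; exact: measurable_prod.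
Qed.

Section clique_bounds.
Context (R : realType) (d0 : measure_display) (T0 : measurableType d0)
  (P0 : probability T0 R) (H : {RV P0 >-> R}) (n : nat)
  (d : measure_display) (T : measurableType d) (P : probability T R)
  (W : 'I_n -> {RV P >-> R}) (adj : T -> rel 'I_n).
Hypothesis graph : chung_lu H W adj.

Definition all_joined (S : {set 'I_n}) : set T :=
  \bigcap_(e in [set` pairs_in S]) [set t | adj t e.1 e.2].

Lemma measurable_all_joined S : measurable (all_joined S).
Proof.
apply: fin_bigcap_measurable; first exact: finite_finset.
by move=> e _; exact: cl_adj_measurable graph _ _.
Qed.

Lemma mem_cliques k (S : {set 'I_n}) t :
  (S \in cliques k (adj t)) = (#|S| == k) && `[< all_joined S t >].
Proof.
rewrite inE; congr (_ && _).
apply/'forall_implyP/asboolP => [Sc [i j]|Sc i iS].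
  rewrite /= inE /= => /and3P[iS jS ij].
  have /forallP/(_ j) := Sc i iS.
  by rewrite jS -(inj_eq val_inj) (ltn_eqF ij).
apply/'forall_implyP => j jS; apply/implyP => ij.
have [lij|lji|eij] := ltngtP i j.
- by apply: (Sc (i, j)); rewrite /= inE iS jS.
- by rewrite (cl_adj_sym graph); apply: (Sc (j, i)); rewrite /= inE iS jS.
- by move: ij; rewrite (val_inj eij) eqxx.
Qed.

Lemma expected_cliquesE k :
  expected_cliques P adj k = (\sum_(S : {set 'I_n} | #|S| == k) P (all_joined S))%E.
Proof.
rewrite /expected_cliques expectation.unlock.
under eq_integral => t _.
  have -> : (#|cliques k (adj t)|%:R : R)%:E =
      (\sum_(S : {set 'I_n} | #|S| == k) (\1_(all_joined S) t)%:E)%E.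
    rewrite sumEFin; congr EFin.
    rewrite -sum1_card natr_sum big_mkcond [RHS]big_mkcond /=.
    apply: eq_bigr => S _; rewrite mem_cliques indicE.
    case: eqP => //= _.
    by case: asboolP => tS; rewrite ?(mem_set tS) ?(memNset tS).
  over.
rewrite -big_filter.
under eq_integral do rewrite -big_filter.
rewrite ge0_integral_sum//; last first.
  by move=> S; apply/measurable_EFinP; apply: measurable_indic;
    exact: measurable_all_joined.
apply: eq_bigr => S _; rewrite integral_indic ?setIT//.
exact: measurable_all_joined.
Qed.

Lemma sum_cliques_le k (c : R) :
  (forall S : {set 'I_n}, #|S| = k -> P (all_joined S) <= c%:E)%E ->
  (expected_cliques P adj k <= ('C(n, k)%:R * c)%:E)%E.
Proof.
move=> Pc; rewrite expected_cliquesE.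
apply: (@le_trans _ _ (\sum_(S : {set 'I_n} | #|S| == k) c%:E)%E).
  by apply: lee_sum => S /eqP; exact: Pc.
rewrite sumEFin sumr_const lee_fin mulr_natl.
by rewrite -[X in 'C(X, _)]card_ord -card_draws cardsE.
Qed.

Lemma sum_cliques_ge k (c : R) :
  (forall S : {set 'I_n}, #|S| = k -> c%:E <= P (all_joined S))%E ->
  (('C(n, k)%:R * c)%:E <= expected_cliques P adj k)%E.
Proof.
move=> Pc; rewrite expected_cliquesE.
apply: (@le_trans _ _ (\sum_(S : {set 'I_n} | #|S| == k) c%:E)%E); last first.
  by apply: lee_sum => S /eqP; exact: Pc.
rewrite sumEFin sumr_const lee_fin mulr_natl.
by rewrite -[X in 'C(X, _)]card_ord -card_draws cardsE.
Qed.

Lemma integral_weight (i : 'I_n) (f : R -> R) :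
  measurable_fun setT f -> (forall x, 0 <= f x) ->
  (\int[P]_t (f (W i t))%:E = \int[P0]_t (f (H t))%:E)%E.
Proof.
move=> mf f0.
have mEf : measurable_fun setT (EFin \o f) by exact/measurable_EFinP.
have f0' y : (0 <= (EFin \o f) y)%E by rewrite lee_fin.
rewrite -(ge0_integral_distribution (W i) mEf f0').
rewrite -(ge0_integral_distribution H mEf f0').
by apply: eq_measure_integral => A mA _; exact: cl_weights_copies graph _ _ mA.
Qed.

Definition weights_in (S : {set 'I_n}) (B : set R) : set T :=
  \bigcap_(i in [set` S]) W i @^-1` B.

(** Makes the conditional probability of the edges usable on [weights_in S B]:
    both bounds below come from conditioning on such an event. *)
Lemma g_sigma_weights_in S B : measurable B ->
  g_sigma_preimage (fun i => W i : T -> R) (weights_in S B).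
Proof.
move=> mB; rewrite /g_sigma_preimage.
set gen := \big[setU/set0]_(i < n) _.
have [sg0 sgC sgU] := smallest_sigma_algebra [set: T] gen.
have gW i : gen (W i @^-1` B).
  by rewrite /gen (bigD1 i)//=; left; exists B => //; rewrite setTI.
(* A finite intersection, written as the complement of a countable union. *)
pose F k : set T := if insub k is Some i then
  (if i \in S then setT `\` W i @^-1` B else set0) else set0.
have -> : weights_in S B = setT `\` \bigcup_k F k.
  apply/seteqP; split=> t /=.
    move=> tB; split=> // -[k _]; rewrite /F.
    by case: insubP => // i _ _; case: ifP => // iS [_]; apply; exact: tB.
  move=> [_ tF] i /= iS; apply: contrapT => tB; apply: tF.
  by exists i => //; rewrite /F valK iS.
apply: (sgC (\bigcup_k F k)); apply: sgU => k; rewrite /F; case: insubP => // i _ _.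
by case: ifP => // _; apply: sgC; exact: sub_gen_smallest.
Qed.

Lemma measurable_weights_in S B : measurable B -> measurable (weights_in S B).
Proof.
move=> mB; apply: fin_bigcap_measurable; first exact: finite_finset.
by move=> i _; exact: measurable_funPTI.
Qed.

Lemma prob_weights_in S B p : measurable B -> P0 (H @^-1` B) = p%:E ->
  P (weights_in S B) = (p ^+ #|S|)%:E.
Proof.
move=> mB Hp; rewrite /weights_in (cl_weights_indep graph (J := S) (B := fun=> B))//.
rewrite (eq_bigr (fun=> p%:E)); last first.
  by move=> i _; rewrite -Hp; exact: cl_weights_copies graph _ _ mB.
by rewrite prodEFin prodr_const.
Qed.

Definition edge_product (S : {set 'I_n}) (x : 'I_n -> R) : R :=
  \prod_(e in pairs_in S) edge_prob (fine 'E_P0[H]) n (x e.1) (x e.2).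

Lemma measurable_edge_product S :
  measurable_fun setT (fun t => edge_product S (W^~ t)).
Proof.
apply: measurable_fun_prod_in => e; rewrite /edge_prob.
apply: measurable_minr => //; apply: measurable_funM => //.
exact: measurable_funM.
Qed.

Lemma prob_weights_in_all_joined S B : measurable B ->
  P (weights_in S B `&` all_joined S) =
  (\int[P]_(t in weights_in S B) (edge_product S (W^~ t))%:E)%E.
Proof.
move=> mB; have [|_ ->//] := cl_edges graph (J := pairs_in S).
  by move=> e; rewrite inE => /and3P[].
exact: g_sigma_weights_in.
Qed.

(** Restricting to the event that all the weights of S are in B, where the
    conditional probability of the clique is at least c. *)
Lemma prob_all_joined_ge (S : {set 'I_n}) B (c p : R) : measurable B -> 0 <= c ->
  P0 (H @^-1` B) = p%:E ->
  (forall x, (forall i, i \in S -> B (x i)) -> c <= edge_product S x) ->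
  ((c * p ^+ #|S|)%:E <= P (all_joined S))%E.
Proof.
move=> mB c0 Hp cx.
have mWB := measurable_weights_in S mB.
apply: (@le_trans _ _ (P (weights_in S B `&` all_joined S))); last first.
  rewrite le_measure ?inE//; [|exact: measurable_all_joined].
  by apply: measurableI => //; exact: measurable_all_joined.
rewrite prob_weights_in_all_joined// EFinM -(prob_weights_in S mB Hp).
rewrite -integral_cst//; apply: ge0_le_integral => //.
  by apply/measurable_EFinP/measurable_funTS; exact: measurable_edge_product.
by move=> t tB; rewrite lee_fin cx.
Qed.

(** A bound of the conditional clique probability that factors over the vertices
    integrates to a product of one-variable moments. The weights of the graph
    are only almost surely at least 1, hence the detour through the event
    [weights_in S B] of probability 1. *)
Lemma prob_all_joined_le (S : {set 'I_n}) (g : R -> R) (e : R) :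
  (forall t, 1 <= H t) ->
  measurable_fun setT g -> (forall x, 0 <= g x) ->
  (\int[P0]_t (g (H t))%:E <= e%:E)%E ->
  (forall x, (forall i, i \in S -> 1 <= x i) ->
     0 <= edge_product S x <= \prod_(i in S) g (x i)) ->
  (P (all_joined S) <= (e ^+ #|S|)%:E)%E.
Proof.
move=> H1 mg g0 ge xg; pose B : set R := [set` `[1, +oo[].
have mB : measurable B by exact: measurable_itv.
have mWB := measurable_weights_in S mB.
have PB : P (weights_in S B) = 1%E.
  rewrite (@prob_weights_in S B 1)// ?expr1n// -[RHS](probability_setT P0).
  by congr (P0 _); apply/seteqP; split=> t //= _; rewrite /B/= in_itv/= H1.
have mA := measurable_all_joined S.
have mAB : measurable (weights_in S B `&` all_joined S) by exact: measurableI.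
have PE : (P (all_joined S) <= P (weights_in S B `&` all_joined S))%E.
  have P0C : P (~` weights_in S B) = 0%E by rewrite probability_setC// PB subee.
  rewrite -[leRHS]adde0 -[X in (_ <= _ + X)%E]P0C.
  apply: (@le_trans _ _ (P (weights_in S B `&` all_joined S `|` ~` weights_in S B))).
    rewrite le_measure ?inE//.
      by apply: measurableU => //; exact: measurableC.
    by move=> t tA; case: (pselect (weights_in S B t)) => tB; [left|right].
  by apply: measureU2 => //; exact: measurableC.
apply: (le_trans PE); rewrite prob_weights_in_all_joined//.
pose e' := fine (\int[P0]_t (g (H t))%:E).
have e'_ge0 : (0 <= \int[P0]_t (g (H t))%:E)%E.
  by apply: integral_ge0 => t _; rewrite lee_fin.
have e'E : (\int[P0]_t (g (H t))%:E = e'%:E)%E.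
  by rewrite fineK// ge0_fin_numE// (le_lt_trans ge)// ltry.
have mprod : measurable_fun setT (fun t => (\prod_(i in S) g (W i t))%:E).
  apply/measurable_EFinP; apply: measurable_fun_prod_in => i.
  exact: measurableT_comp.
have prod0 t : (0 <= (\prod_(i in S) g (W i t))%:E)%E.
  by rewrite lee_fin prodr_ge0.
apply: (@le_trans _ _ (\int[P]_t (\prod_(i in S) g (W i t))%:E)%E); last first.
  rewrite (@indep_integral_prod _ _ _ _ _ W (fun=> g) (fun=> e'))//.
  - rewrite prodr_const lee_fin; apply: lerXn2r; rewrite ?nnegrE.
    + by rewrite -lee_fin -e'E.
    + by rewrite -lee_fin (le_trans _ ge).
    + by rewrite -lee_fin -e'E.
  - exact: cl_weights_indep graph.
  - by move=> i; rewrite integral_weight.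
apply: (@le_trans _ _
    (\int[P]_(t in weights_in S B) (\prod_(i in S) g (W i t))%:E)%E); last first.
  by apply: ge0_subset_integral.
have W1 t : weights_in S B t -> forall i, i \in S -> 1 <= W i t.
  by move=> tB i iS; have := tB i iS; rewrite /B/= in_itv/= andbT.
apply: ge0_le_integral => //.
- by move=> t /W1/xg/andP[]; rewrite lee_fin.
- by apply/measurable_EFinP/measurable_funTS; exact: measurable_edge_product.
- exact: measurable_funTS.
- by move=> t /W1/xg/andP[]; rewrite lee_fin.
Qed.

End clique_bounds.

(** * Moments of the weights *)

Lemma ltr_powR_exp2 (R : realType) (x y : R) : x < y -> 2 `^ x < 2 `^ y :> R.
Proof.
move=> xy; have -> : y = x + (y - x) by ring.
rewrite powRD ?pnatr_eq0 ?implybT// ltr_pMr ?powR_gt0//.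
rewrite -[ltLHS]/((fun=> 1) (y - x)) -powR1.
by apply: gt0_ltr_powR; rewrite ?nnegrE ?subr_gt0 ?ltr1n.
Qed.

Lemma slowly_varying_bounds (R : realType) (l : R -> R) (c lo hi : R) :
  slowly_varying l -> 0 < c -> lo < 1 -> 1 < hi ->
  exists2 M : R, 1 <= M &
    forall x, M <= x -> lo * l x <= l (c * x) <= hi * l x.
Proof.
move=> [l0 lv] c0 lo1 hi1.
have [M1 [_ H1]] := cvgr_gt _ (lv c c0) _ lo1.
have [M2 [_ H2]] := cvgr_lt _ (lv c c0) _ hi1.
exists (Num.max 1 (Num.max (M1 + 1) (M2 + 1))); first by rewrite le_max lexx.
move=> x; rewrite !ge_max => /and3P[x1 xM1 xM2].
have lx := l0 _ x1.
rewrite -ler_pdivlMr// -[X in _ && X]ler_pdivrMr//.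
by rewrite !ltW ?H1 ?H2//; lra.
Qed.

(** The vertex factor of [prod_min_le_prod_powR] for a weight x rescaled by m. *)
Definition cut_powR (R : realType) (m beta gamma x : R) : R :=
  if x / m <= 1 then (x / m) `^ beta else (x / m) `^ gamma.

Lemma measurable_cut_powR (R : realType) (m beta gamma : R) :
  measurable_fun setT (cut_powR m beta gamma).
Proof.
have mdiv : measurable_fun setT (fun x : R => x / m).
  by apply: measurable_funM.
apply: measurable_fun_ifT.
- exact: measurable_fun_ler.
- exact: measurableT_comp (measurable_powR _) mdiv.
- exact: measurableT_comp (measurable_powR _) mdiv.
Qed.

Section regularly_varying_tail.
Context (R : realType) (alpha : R) (l : R -> R) (d : measure_display)
  (T : measurableType d) (P : probability T R) (H : {RV P >-> R}).
Hypotheses (l_sv : slowly_varying l) (H_ge1 : forall t, 1 <= H t)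
  (H_tail : forall h, 1 <= h -> ccdf H h = (h `^ (1 - alpha) * l h)%:E).

Let G h := h `^ (1 - alpha) * l h.

Lemma tail_gt0 h : 1 <= h -> 0 < G h.
Proof.
move=> h1; rewrite mulr_gt0 ?powR_gt0 ?(lt_le_trans ltr01 h1)//.
exact: (proj1 l_sv).
Qed.

Lemma prob_gt_tail h : 1 <= h -> P [set t | h < H t] = (G h)%:E.
Proof.
move=> h1; rewrite -H_tail// /ccdf /distribution /pushforward.
by congr (P _); apply/seteqP; split=> t /=; rewrite in_itv/= andbT.
Qed.

(** The ratio G (2 * x) / G x tends to 2 ^ (1 - alpha); this is the form in which
    slow variation enters the bounds on truncated moments. *)
Lemma tail_doubling (a b : R) :
  a < 2 `^ (1 - alpha) -> 2 `^ (1 - alpha) < b ->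
  exists2 x0 : R, 1 <= x0 &
    forall x, x0 <= x -> a * G x <= G (2 * x) <= b * G x.
Proof.
set q := 2 `^ (1 - alpha) => aq qb.
have q0 : 0 < q by rewrite powR_gt0.
have [|||x0 x01 Hx0] := @slowly_varying_bounds _ l 2 (a / q) (b / q) l_sv.
- by [].
- by rewrite ltr_pdivrMr ?mul1r.
- by rewrite ltr_pdivlMr ?mul1r.
exists x0 => // x xx0; have /andP[lo hi] := Hx0 _ xx0.
have x0' : 0 < x by lra.
rewrite /G powRM ?(ltW x0')// -/q.
set p := x `^ (1 - alpha); have p0 : 0 < p by rewrite powR_gt0.
have qp0 : 0 < q * p by rewrite mulr_gt0.
apply/andP; split.
  have -> : a * (p * l x) = (q * p) * (a / q * l x) by field; rewrite gt_eqF.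
  by rewrite ler_pM2l.
have -> : b * (p * l x) = (q * p) * (b / q * l x) by field; rewrite gt_eqF.
by rewrite ler_pM2l.
Qed.

Lemma lower_truncated_moment_tail (beta : R) : 0 <= beta -> alpha - 1 < beta ->
  exists x0 C : R, [/\ 1 <= x0, 0 < C & forall m, x0 <= m ->
    (\int[P]_(t in [set t | (H t <= m)%R]) (H t `^ beta)%:E <=
      (C * (m `^ beta * G m))%:E)%E].
Proof.
move=> beta0 betaa.
have := @ltr_powR_exp2 R (- beta) (1 - alpha) ltac:(lra) => bq.
have [aL aR] := midf_lt bq.
(* a is the midpoint of 2 ^ (- beta) and 2 ^ (1 - alpha). *)
set a := _ / _ in aL aR.
have [|x0 x01 dbl] := tail_doubling aR (b := 2 `^ (1 - alpha) + 1); first lra.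
have pos : 0 < x0 by lra.
have [||||C C0 HC] := @lower_truncated_moment _ _ _ P H G x0 pos _ _ _ a beta beta0 aL.
- by move=> t; apply: le_trans (H_ge1 t).
- by move=> x xx0; apply: tail_gt0; lra.
- by move=> x xx0; apply: prob_gt_tail; lra.
- by move=> x /dbl/andP[].
by exists x0, C; split.
Qed.

Lemma upper_truncated_moment_tail (gamma : R) : 0 <= gamma -> gamma < alpha - 1 ->
  exists x0 C : R, [/\ 1 <= x0, 0 < C & forall m, x0 <= m ->
    (\int[P]_(t in [set t | (m < H t)%R]) (H t `^ gamma)%:E <=
      (C * (m `^ gamma * G m))%:E)%E].
Proof.
move=> gamma0 gammaa.
have := @ltr_powR_exp2 R (1 - alpha) (- gamma) ltac:(lra) => bq.
have [bL bR] := midf_lt bq.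
(* b is the midpoint of 2 ^ (1 - alpha) and 2 ^ (- gamma). *)
set b := _ / _ in bL bR.
have b0 : 0 < b by apply: lt_trans bL; rewrite powR_gt0.
have [|x0 x01 dbl] := tail_doubling (a := 2 `^ (1 - alpha) - 1) _ bL; first lra.
have pos : 0 < x0 by lra.
have [||||C C0 HC] := @upper_truncated_moment _ _ _ P H G x0 pos _ _ _ b gamma gamma0 b0 bR.
- by move=> t; apply: le_trans (H_ge1 t).
- by move=> x xx0; apply: tail_gt0; lra.
- by move=> x xx0; apply: prob_gt_tail; lra.
- by move=> x /dbl/andP[].
by exists x0, C; split.
Qed.

Lemma RV_le_gtE (m : R) :
  [set: T] = [set t | (H t <= m)%R] `|` [set t | (m < H t)%R].
Proof.
by apply/seteqP; split=> t //= _; case: (leP (H t) m) => h; [left|right].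
Qed.

Lemma ge0_integral_split (m : R) (f : T -> \bar R) :
  measurable_fun setT f -> (forall t, 0 <= f t)%E ->
  (\int[P]_t f t = \int[P]_(t in [set t | (H t <= m)%R]) f t +
                   \int[P]_(t in [set t | (m < H t)%R]) f t)%E.
Proof.
move=> mf f0; rewrite {1}(RV_le_gtE m) ge0_integral_setU//.
- exact: measurable_RV_le.
- exact: measurable_RV_gt.
- by rewrite -RV_le_gtE.
- by apply/disj_setPS => t [/= h1 /(le_lt_trans h1)]; rewrite ltxx.
Qed.

Lemma finite_moment (gamma : R) : 0 <= gamma -> gamma < alpha - 1 ->
  exists2 M : R, 0 < M & (\int[P]_t (H t `^ gamma)%:E <= M%:E)%E.
Proof.
move=> gamma0 gammaa.
have [x0 [C [x01 C0 HC]]] := upper_truncated_moment_tail gamma0 gammaa.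
have Gx0 := tail_gt0 x01.
have pos : 0 < x0 by lra.
exists (x0 `^ gamma + C * (x0 `^ gamma * G x0)).
  apply: addr_gt0; first exact: powR_gt0.
  by apply: mulr_gt0 => //; apply: mulr_gt0 => //; exact: powR_gt0.
rewrite (ge0_integral_split x0); last 2 first.
- exact: measurable_fun_powR_RV.
- by move=> t; rewrite lee_fin powR_ge0.
rewrite EFinD; apply: leeD; last exact: HC.
apply: (@le_trans _ _ ((x0 `^ gamma)%:E * P [set t | (H t <= x0)%R])%E).
  apply: integral_powR_le => //; first exact: measurable_RV_le.
  by move=> t /= ->; rewrite (le_trans ler01 (H_ge1 t)).
rewrite -[leRHS]mule1; apply: lee_wpmul2l; first by rewrite lee_fin powR_ge0.
by apply: probability_le1; exact: measurable_RV_le.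
Qed.

Lemma mean_ge1 : 2 < alpha -> 1 <= fine 'E_P[H].
Proof.
move=> alpha2.
have [||M M0 HM] := @finite_moment 1; [lra|lra|].
have EE : ('E_P[H] = \int[P]_t (H t `^ 1)%:E)%E.
  rewrite expectation_def; apply: eq_integral => t _.
  by rewrite powRr1// (le_trans ler01).
have E1 : (1 <= 'E_P[H])%E.
  rewrite expectation_def.
  have -> : (1 = \int[P]_t (cst 1%E t))%E.
    by rewrite integral_cst// mul1e; exact/esym/probability_setT.
  apply: ge0_le_integral => //; first exact/measurable_EFinP.
  by move=> t _; rewrite lee_fin.
rewrite -lee_fin fineK// ge0_fin_numE.
  by rewrite EE (le_lt_trans HM)// ltry.
by apply: le_trans E1.
Qed.

(** On each side of m the exponent is the one for which the truncated moment is
    governed by its values near m, hence comparable with the tail at m. *)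
Lemma cut_moment_le (beta gamma : R) :
  0 <= gamma -> gamma < alpha - 1 -> alpha - 1 < beta ->
  exists x0 C : R, [/\ 1 <= x0, 0 < C & forall m, x0 <= m ->
    (\int[P]_t (cut_powR m beta gamma (H t))%:E <= (C * G m)%:E)%E].
Proof.
move=> gamma0 gammaa betaa.
have beta0 : 0 <= beta by lra.
have [x1 [C1 [x11 C10 H1]]] := lower_truncated_moment_tail beta0 betaa.
have [x2 [C2 [x21 C20 H2]]] := upper_truncated_moment_tail gamma0 gammaa.
exists (Num.max x1 x2), (C1 + C2); split; first by rewrite le_max x11.
  by rewrite addr_gt0.
move=> m; rewrite ge_max => /andP[m1 m2].
have m0 : 0 < m by lra.
have powE p t : ((H t / m) `^ p)%:E = ((m `^ p)^-1%:E * (H t `^ p)%:E)%E.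
  have h : 0 <= H t by rewrite (le_trans ler01).
  rewrite powRM ?invr_ge0 ?(ltW m0)// -EFinM mulrC; congr (_ * _)%:E.
  by rewrite -(powR_inv1 (ltW m0)) -powRrM mulN1r powRN.
have intE p D : measurable D ->
    (\int[P]_(t in D) ((H t / m) `^ p)%:E =
     (m `^ p)^-1%:E * \int[P]_(t in D) (H t `^ p)%:E)%E.
  move=> mD; under eq_integral do rewrite powE.
  rewrite ge0_integralZl//.
  - exact: measurable_fun_powR_RV.
  - by move=> t _; rewrite lee_fin powR_ge0.
  - by rewrite lee_fin invr_ge0 powR_ge0.
rewrite (ge0_integral_split m); last 2 first.
- by apply/measurable_EFinP; apply: measurableT_comp => //;
    exact: measurable_cut_powR.
- by move=> t; rewrite lee_fin /cut_powR; case: ifP => _; exact: powR_ge0.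
rewrite mulrDl EFinD; apply: leeD.
- rewrite (eq_integral (fun t => ((H t / m) `^ beta)%:E)); last first.
    move=> t; rewrite inE/= => Hm.
    by rewrite /cut_powR ler_pdivrMr// mul1r Hm.
  rewrite intE; last exact: measurable_RV_le.
  apply: (@le_trans _ _ ((m `^ beta)^-1%:E * (C1 * (m `^ beta * G m))%:E)%E).
    by apply: lee_wpmul2l; rewrite ?H1// lee_fin invr_ge0 powR_ge0.
  rewrite -EFinM lee_fin (mulrCA C1) mulKf// gt_eqF// powR_gt0//.
- rewrite (eq_integral (fun t => ((H t / m) `^ gamma)%:E)); last first.
    move=> t; rewrite inE/= => Hm.
    by rewrite /cut_powR ler_pdivrMr// mul1r leNgt Hm.
  rewrite intE; last exact: measurable_RV_gt.
  apply: (@le_trans _ _ ((m `^ gamma)^-1%:E * (C2 * (m `^ gamma * G m))%:E)%E).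
    by apply: lee_wpmul2l; rewrite ?H2// lee_fin invr_ge0 powR_ge0.
  by rewrite -EFinM lee_fin (mulrCA C2) mulKf// gt_eqF// powR_gt0.
Qed.

End regularly_varying_tail.

(** * Asymptotic comparison *)

Lemma bin_le_exp (n k : nat) : ('C(n, k) <= n ^ k)%N.
Proof.
apply: (@leq_trans (n ^_ k)).
  by rewrite -bin_ffact leq_pmulr// fact_gt0.
rewrite ffact_prod -[k in (_ ^ k)%N]card_ord -prod_nat_const.
by apply: leq_prod => i _; exact: leq_subr.
Qed.

Lemma exp_le_bin (n k : nat) : (2 * k <= n)%N ->
  (n ^ k <= 2 ^ k * k`! * 'C(n, k))%N.
Proof.
move=> kn; rewrite -mulnA [(_`! * _)%N]mulnC bin_ffact ffact_prod.
rewrite -[k in (n ^ k)%N]card_ord -[k in (2 ^ k)%N]card_ord -!prod_nat_const.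
rewrite -big_split /=; apply: leq_prod => i _.
by have := ltn_ord i; lia.
Qed.

(** The number 'C(n, k) of k-sets may be replaced by n ^ k, since the two have
    the same order. *)
Lemma same_order_binom (R : realType) (k : nat) (f : nat -> \bar R)
    (g v : nat -> R) (n0 : nat) (c1 c2 : R) :
  0 < c1 -> 0 < c2 ->
  (forall n, (n0 < n)%N ->
    [/\ 0 <= v n, g n = n%:R ^+ k * v n,
        (('C(n, k)%:R * (c1 * v n))%:E <= f n)%E &
        (f n <= ('C(n, k)%:R * (c2 * v n))%:E)%E]) ->
  same_order f (fun n => (g n)%:E).
Proof.
move=> c10 c20 fv.
pose b : R := (2 ^ k * k`!)%:R.
have b0 : 0 < b by rewrite ltr0n muln_gt0 expn_gt0 fact_gt0.
exists (maxn n0 (2 * k)), (c1 / b), (c1 / b + c2); split.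
- by rewrite divr_gt0.
- by rewrite ltrDl.
move=> n; rewrite gtn_max => /andP[n0n /ltnW kn].
have [v0 -> lo hi] := fv n n0n.
split.
  apply: le_trans lo; rewrite -EFinM lee_fin.
  have : n%:R ^+ k <= b * 'C(n, k)%:R by rewrite -natrX -natrM ler_nat exp_le_bin.
  rewrite -ler_pdivrMl// => nb.
  have -> : c1 / b * (n%:R ^+ k * v n) = (b^-1 * n%:R ^+ k) * (c1 * v n) by ring.
  by rewrite ler_wpM2r// mulr_ge0// ltW.
apply: (le_trans hi); rewrite -EFinM lee_fin.
have nb : 'C(n, k)%:R <= n%:R ^+ k :> R by rewrite -natrX ler_nat bin_le_exp.
apply: (@le_trans _ _ (n%:R ^+ k * (c2 * v n))).
  by rewrite ler_wpM2r// mulr_ge0// ltW.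
rewrite [leRHS]mulrC -mulrA ler_wpM2l ?exprn_ge0// [leRHS]mulrC ler_wpM2r//.
by rewrite lerDr divr_ge0 ?ltW.
Qed.

Lemma edge_prob_rescale (R : realType) (mu m x y : R) (n : nat) :
  mu * n%:R = m ^+ 2 ->
  edge_prob mu n x y = Num.min ((x / m) * (y / m)) 1.
Proof. by move=> E; rewrite /edge_prob E mulf_div -expr2. Qed.

(** Rewrites the target powers of n in terms of sqrt n, the variable in which
    the clique probabilities are computed. *)
Lemma powR_half_exponent (R : realType) (k : nat) (p : R) (n : nat) : (0 < n)%N ->
  n%:R `^ (k%:R / 2 * p) =
  n%:R ^+ k * (Num.sqrt n%:R `^ (p - 2)) ^+ k.
Proof.
move=> n0; have n0' : 0 < n%:R :> R by rewrite ltr0n.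
have s0 : 0 < Num.sqrt n%:R :> R by rewrite sqrtr_gt0.
rewrite -exprMn.
have -> : n%:R * Num.sqrt n%:R `^ (p - 2) = Num.sqrt n%:R `^ p :> R.
  rewrite -[X in X * _](sqr_sqrtr (ltW n0')) -powR_mulrn ?ltW//.
  by rewrite -powRD ?(gt_eqF s0) ?implybT//; congr (_ `^ _); ring.
have -> : k%:R / 2 * p = 2^-1 * (p * k%:R) :> R by ring.
rewrite powRrM powR12_sqrt ?ler0n// powRrM powR_mulrn// powR_ge0.
Qed.

Theorem corollary3p2 (R : realType) (alpha : R) (k : nat) (l : R -> R)
    (d0 : measure_display) (T0 : measurableType d0) (P0 : probability T0 R)
    (H : {RV P0 >-> R})
    (d : nat -> measure_display) (T : forall n, measurableType (d n))
    (P : forall n, probability (T n) R)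
    (W : forall n, 'I_n -> {RV (P n) >-> R})
    (adj : forall n, T n -> rel 'I_n)
    (alpha_gt2 : 2 < alpha) (alpha_nonint : alpha \isn't a Num.int)
    (k_ge2 : (2 <= k)%N)
    (l_sv : slowly_varying l)
    (H_ge1 : forall t, 1 <= H t)
    (H_tail : forall h, 1 <= h -> ccdf H h = (h `^ (1 - alpha) * l h)%:E)
    (graph : forall n, chung_lu H (@W n) (@adj n)) :
  (k%:R < alpha ->
     same_order (fun n => expected_cliques (P n) (@adj n) k)
       (fun n => (n%:R `^ (k%:R / 2 * (3 - k%:R)))%:E)) /\
  (alpha < k%:R ->
     same_order (fun n => expected_cliques (P n) (@adj n) k)
       (fun n => (n%:R `^ (k%:R / 2 * (3 - alpha))
                  * l (Num.sqrt n%:R) ^+ k)%:E)).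
Proof.
have mu1 := mean_ge1 l_sv H_ge1 H_tail alpha_gt2.
set mu := fine _ in mu1.
have mu0 : 0 < mu by lra.
pose s n : R := Num.sqrt n%:R.
(* Dividing weights by m shares the normalisation mu * n = m ^ 2 evenly between
   the two ends of an edge. *)
pose m n : R := Num.sqrt mu * s n.
have sqmu1 : 1 <= Num.sqrt mu by rewrite -(sqrtr1 R) ler_wsqrtr.
have sqmu0 : 0 < Num.sqrt mu by lra.
have mE n : mu * n%:R = m n ^+ 2.
  by rewrite exprMn !sqr_sqrtr ?ler0n// ltW.
have s1 n : (0 < n)%N -> 1 <= s n.
  by move=> n0; rewrite -(sqrtr1 R) ler_wsqrtr// ler1n.
have s0 n : 0 <= s n by rewrite sqrtr_ge0.
have ms n : s n <= m n by rewrite ler_peMl.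
have s_large (K : R) : exists n0 : nat, forall n, (n0 < n)%N -> K <= s n.
  exists (Num.bound (K ^+ 2)) => n n0.
  apply: (@le_trans _ _ `|K|); first exact: ler_norm.
  rewrite -sqrtr_sqr ler_wsqrtr// (le_trans (ltW (archi_boundP (sqr_ge0 K))))//.
  by rewrite ler_nat ltnW.
have edgeE n (S : {set 'I_n}) x : edge_product H S x =
    \prod_(e in pairs_in S) Num.min ((x e.1 / m n) * (x e.2 / m n)) 1.
  by apply: eq_bigr => e _; exact: edge_prob_rescale.
have edge0 n (S : {set 'I_n}) x : (0 < n)%N ->
    (forall i, i \in S -> 1 <= x i) -> 0 <= edge_product H S x.
  move=> n0 x1; rewrite edgeE; apply: prodr_ge0 => e.
  rewrite inE => /and3P[e1 e2 _]; rewrite le_min ler01 andbT.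
  have := s1 _ n0; have := ms n; have := x1 _ e1; have := x1 _ e2.
  by move=> *; rewrite mulr_ge0// divr_ge0//; lra.
split=> [k_lt|k_gt].
- have k1E : k.-1%:R = k%:R - 1 :> R by rewrite -subn1 natrB// ltnW.
  have [||M M0 HM] := @finite_moment _ _ _ _ _ P0 H l_sv H_ge1 H_tail k.-1%:R.
  + exact: ler0n.
  + by rewrite k1E; lra.
  pose c : R := (Num.sqrt mu)^-1 ^+ k.-1.
  have c0 : 0 < c by rewrite exprn_gt0// invr_gt0.
  apply: (@same_order_binom _ k _ _ (fun n => ((s n)^-1 ^+ k.-1) ^+ k) 0
    (c ^+ k) ((c * M) ^+ k)).
  + by rewrite exprn_gt0.
  + by rewrite exprn_gt0// mulr_gt0.
  move=> n n0; have sn1 := s1 _ n0; have msn := ms n.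
  have minv : (m n)^-1 ^+ k.-1 = c * (s n)^-1 ^+ k.-1.
    by rewrite /m invfM exprMn.
  split.
  + by rewrite !exprn_ge0// invr_ge0.
  + rewrite powR_half_exponent//; congr (_ * _ ^+ _).
    rewrite -powR_mulrn ?invr_ge0// -(powR_inv1 (s0 n)) -powRrM k1E.
    by congr (_ `^ _); ring.
  (* All weights are at least 1, so every edge has probability at least m ^ -2. *)
  + apply: (sum_cliques_ge (graph n)) => S cS.
    have := @prob_all_joined_ge _ _ _ _ _ _ _ _ _ _ _ (graph n) S
      [set` `[1, +oo[] (((m n)^-1 ^+ k.-1) ^+ k) 1.
    rewrite expr1n mulr1 minv exprMn; apply => //.
    * by rewrite mulr_ge0 ?exprn_ge0 ?invr_ge0// ltW.
    * rewrite -[RHS](probability_setT P0).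
      by congr (P0 _); apply/seteqP; split=> t //= _; rewrite in_itv/= H_ge1.
    move=> x x1; rewrite edgeE -exprMn -minv.
    apply: (@le_trans _ _ (\prod_(e in pairs_in S) ((m n)^-1 * (m n)^-1))).
      by rewrite (prod_pairs_in_mul (fun=> (m n)^-1) cS) prodr_const cS.
    apply: ler_prod => e; rewrite inE => /and3P[e1 e2 _].
    have m0 : 0 < (m n)^-1 by rewrite invr_gt0; lra.
    have m1 : (m n)^-1 <= 1 by rewrite invf_le1; lra.
    have xm i : i \in S -> (m n)^-1 <= x i / m n.
      by move=> /x1; rewrite /= in_itv/= andbT => xi; rewrite ler_peMl// ltW.
    rewrite mulr_ge0 ?(ltW m0)//= le_min; apply/andP; split.
      by apply: ler_pM; rewrite ?xm// ltW.
    by apply: mulr_ile1 => //; exact: ltW.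
  (* Bound min(u, 1) by u and use the finite moment of order k - 1. *)
  + apply: (sum_cliques_le (graph n)) => S cS.
    rewrite -exprMn mulrAC -minv.
    have := @prob_all_joined_le _ _ _ _ _ _ _ _ _ _ _ (graph n) S
      (fun x => (m n)^-1 ^+ k.-1 * x `^ k.-1%:R) ((m n)^-1 ^+ k.-1 * M).
    rewrite cS; apply => //.
    * by apply: measurable_funM => //; exact: measurable_powR.
    * by move=> x; rewrite mulr_ge0 ?powR_ge0// exprn_ge0// invr_ge0; lra.
    * under eq_integral do rewrite EFinM.
      rewrite ge0_integralZl//.
      - rewrite EFinM; apply: lee_wpmul2l => //.
        by rewrite lee_fin exprn_ge0// invr_ge0; lra.
      - exact: measurable_fun_powR_RV.
      - by move=> t _; rewrite lee_fin powR_ge0.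
      - by rewrite lee_fin exprn_ge0// invr_ge0; lra.
    move=> x x1; rewrite edge0//= edgeE.
    have -> : \prod_(i in S) ((m n)^-1 ^+ k.-1 * x i `^ k.-1%:R) =
        \prod_(i in S) (x i / m n) ^+ k.-1.
      apply: eq_bigr => i /x1 xi; rewrite powR_mulrn; last lra.
      by rewrite exprMn mulrC.
    rewrite -(prod_pairs_in_mul (fun i => x i / m n) cS).
    apply: ler_prod => e; rewrite inE => /and3P[/x1 e1 /x1 e2 _].
    rewrite ge_min lexx andbT le_min ler01 andbT.
    by rewrite mulr_ge0// divr_ge0//; lra.
have [beta [gamma [gamma0 gammaa betaa prodH]]] :=
  prod_min_le_prod_powR alpha_gt2 alpha_nonint k_gt.
have [x0 [C [x01 C0 HC]]] :=
  @cut_moment_le _ _ _ _ _ P0 H l_sv H_ge1 H_tail _ _ gamma0 gammaa betaa.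
have [||M M1 HM] := @slowly_varying_bounds _ l (Num.sqrt mu) 2^-1 2 l_sv sqmu0.
- lra.
- lra.
have [n0 Hn0] := s_large (Num.max x0 M).
pose c := Num.sqrt mu `^ (1 - alpha).
have c0 : 0 < c by rewrite powR_gt0.
apply: (@same_order_binom _ k _ _ (fun n => (s n `^ (1 - alpha) * l (s n)) ^+ k) n0
  ((c / 2) ^+ k) ((C * (2 * c)) ^+ k)).
- by rewrite exprn_gt0// divr_gt0.
- by rewrite exprn_gt0// !mulr_gt0.
move=> n nn0; have := Hn0 _ nn0; rewrite ge_max => /andP[sx0 sM].
have n_gt0 : (0 < n)%N by exact: leq_ltn_trans nn0.
have sn1 := s1 _ n_gt0; have msn := ms n.
have lsn : 0 < l (s n) by apply: (proj1 l_sv).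
have psn : 0 < s n `^ (1 - alpha) by rewrite powR_gt0//; lra.
have Gm : m n `^ (1 - alpha) * l (m n) =
    c * s n `^ (1 - alpha) * l (Num.sqrt mu * s n).
  by rewrite /m powRM ?s0// ltW.
have cs0 : 0 < c * s n `^ (1 - alpha) by rewrite mulr_gt0.
have /andP[lo hi] := HM _ sM.
have m1 : 1 <= m n by lra.
have mx0 : x0 <= m n by lra.
have lm0 : 0 < l (m n) by apply: (proj1 l_sv).
have Gm0 : 0 < m n `^ (1 - alpha) * l (m n).
  by rewrite mulr_gt0// powR_gt0; lra.
split.
- by rewrite exprn_ge0// mulr_ge0 ?ltW.
- rewrite powR_half_exponent// exprMn mulrA; congr (_ * _ ^+ _ * _).
  by congr (_ `^ _); ring.
(* Two vertices of weight above m are joined with conditional probability 1. *)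
- apply: (sum_cliques_ge (graph n)) => S cS.
  apply: (@le_trans _ _ ((m n `^ (1 - alpha) * l (m n)) ^+ k)%:E).
    rewrite lee_fin -exprMn; apply: lerXn2r; rewrite ?nnegrE ?(ltW Gm0)//.
      by rewrite !mulr_ge0 ?ltW.
    have -> : c / 2 * (s n `^ (1 - alpha) * l (s n)) =
      c * s n `^ (1 - alpha) * (2^-1 * l (s n)) by ring.
    by rewrite Gm ler_pM2l.
  have := @prob_all_joined_ge _ _ _ _ _ _ _ _ _ _ _ (graph n) S
    [set` `]m n, +oo[] 1 (m n `^ (1 - alpha) * l (m n)).
  rewrite cS mul1r; apply => //.
    rewrite -(prob_gt_tail H_tail m1); congr (P0 _).
    by apply/seteqP; split=> t /=; rewrite in_itv/= andbT.
  move=> x xm; rewrite edgeE big1// => e; rewrite inE => /and3P[e1 e2 _].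
  have xm1 i : i \in S -> 1 <= x i / m n.
    move=> /xm; rewrite /= in_itv/= andbT => /ltW xi.
    by rewrite ler_pdivlMr ?mul1r//; lra.
  apply/min_idPr; rewrite -[leLHS]mulr1.
  by apply: ler_pM; rewrite ?xm1.
- apply: (sum_cliques_le (graph n)) => S cS.
  apply: (@le_trans _ _ ((C * (m n `^ (1 - alpha) * l (m n))) ^+ k)%:E); last first.
    rewrite lee_fin -exprMn; apply: lerXn2r.
    - by rewrite nnegrE ltW// mulr_gt0.
    - by rewrite nnegrE ltW// !mulr_gt0.
    have -> : C * (2 * c) * (s n `^ (1 - alpha) * l (s n)) =
      C * (c * s n `^ (1 - alpha) * (2 * l (s n))) by ring.
    by rewrite Gm ler_pM2l// ler_pM2l.
  have := @prob_all_joined_le _ _ _ _ _ _ _ _ _ _ _ (graph n) S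
    (cut_powR (m n) beta gamma) (C * (m n `^ (1 - alpha) * l (m n))).
  rewrite cS; apply => //.
  + exact: measurable_cut_powR.
  + by move=> x; rewrite /cut_powR; case: ifP => _; exact: powR_ge0.
  + exact: HC.
  move=> x x1; rewrite edge0//= edgeE.
  apply: (prodH _ S (fun i => x i / m n) cS) => i /x1 xi.
  by rewrite divr_gt0//; lra.
Qed.
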